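(* Consider the game of competition in dual spheres (as specified in the context). Assume the joint signal distribution $F_{s_A,s_B}$ satisfies: for each $i\in\{A,B\}$ and every bounded measurable $g:S_{-i}\to\mathbb{R}$, if $\mathbb{E}[g(s_{-i})\mid s_i]=0$ for $F_{s_i}$-a.e. $s_i$, then $\Pr(g(s_{-i})=0\mid s_i)=1$ for $F_{s_i}$-a.e. $s_i$. In any Bayes-Nash equilibrium $(\sigma_A^*,\sigma_B^*,\alpha^* )$ in which the firms play identifiable strategies, $m(x_A,x_B)+v_{\alpha^*}(x_A,x_B)$ is almost surely constant on path, i.e., there is a constant $c$ such that $m(x_A,x_B)+v_{\alpha^*}(x_A,x_B)=c$ for almost every $(x_A,x_B)$ under the joint distribution of actions induced by $(\sigma_A^*,\sigma_B^* )$ and $F_{s_A,s_B}$.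
   Context: Competition in dual spheres. There are two firms $A,B$ ($-i$ denotes the firm other than $i$), a state $\theta\in\Theta\subset\mathbb{R}^n$, and private signals $s_i\in S_i\subset\mathbb{R}^n$ for each firm, drawn from a joint distribution $F_{s_A,s_B\mid\theta}$ conditional on $\theta$; $F_{s_A,s_B}$ is the unconditional joint signal distribution, with marginals $F_{s_A},F_{s_B}$ having supports $S_A,S_B$, and it is absolutely continuous with respect to $F_{s_A}\otimes F_{s_B}$. The firms simultaneously choose $x_i\in X_i$ ($X_i$ standard Borel). Firm $A$'s private market share is $m(x_A,x_B)\in[0,1]$, where $m:X_A\times X_B\to[0,1]$. A government observes the statistic $t=\tau(x_A,x_B)\in\mathcal{T}$ and then chooses an action $a\in\mathcal{A}$; its payoff is $u_G(x_A,x_B,a,\theta)$. For a bounded function $v:\mathcal{A}\to\mathbb{R}$, firm $A$'s payoff is $m(x_A,x_B)+v(a)$ and firm $B$'s is $-m(x_A,x_B)-v(a)$. All spaces are standard Borel, all maps are measurable, and expectations are assumed well defined. A firm strategy is a measurable $\sigma_i:S_i\to\Delta(X_i)$; a government strategy is $\alpha:\mathcal{T}\to\Delta(\mathcal{A})$. Define $v_\alpha(x_A,x_B):=\mathbb{E}[v(\alpha(\tau(x_A,x_B)))]$, the expectation being over the government's randomization. A Bayes-Nash equilibrium is a profile in which each firm (for a.e. own signal) and the government maximize their expected payoffs given the others' strategies. Identifiable strategy: $\sigma_i$ is identifiable if for every bounded measurable $g:X_i\to\mathbb{R}$, [$\mathbb{E}[g(x_i)\mid s_i]=0$ for $F_{s_i}$-a.e.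 $s_i$] implies [$\Pr(g(x_i)=0\mid s_i)=1$ for $F_{s_i}$-a.e. $s_i$], where expectation and probability are taken under $x_i\sim\sigma_i(\cdot\mid s_i)$. *)

(* Defs.v *)
(* MathComp / MathComp-Analysis. *)
From HB Require Import structures.
From mathcomp Require Import all_boot all_order all_algebra.
From mathcomp Require Import all_classical all_reals all_analysis.
From mathcomp Require Import measurable_realfun.

Set Implicit Arguments.
Unset Strict Implicit.
Unset Printing Implicit Defensive.

Import Order.TTheory GRing.Theory Num.Theory.
Import numFieldNormedType.Exports.

Local Open Scope classical_set_scope.
Local Open Scope ring_scope.

(* [f] is a Borel isomorphism from [T] onto a Polish space [P]: a complete
   Hausdorff (hence metrizable) pseudometric space with a countable dense set. *)
Definition standard_borel (R : realType) d (T : measurableType d) : Prop :=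
  exists (P : completePseudoMetricType R) (f : T -> P),
    [/\ hausdorff_space P,
        exists2 D : set P, countable D & dense D,
        bijective f
      & forall A : set T, measurable A <-> <<s @open P >> (f @` A)].

(* A nonempty subspace [S] of [T]. Nonemptiness is part of the type because
   measurable types are pointed. *)
Definition pointed_sub (T : topologicalType) (S : set T) (S0 : S !=set0) :
  Type := S.

HB.instance Definition _ (T : topologicalType) (S : set T) (S0 : S !=set0) :=
  Topological.copy (pointed_sub S0) (set_type S).

HB.instance Definition _ (T : topologicalType) (S : set T) (S0 : S !=set0) :=
  isPointed.Build (pointed_sub S0)
    (exist _ (projT1 (cid S0)) (mem_set (projT2 (cid S0)))).

(* [S] with the Borel sigma-algebra of its relative topology *)
Notation borel_sub S0 := (g_sigma_algebraType (@open (pointed_sub S0))).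

Definition sub_val (T : topologicalType) (S : set T) (S0 : S !=set0)
  (x : borel_sub S0) : T := set_val (x : set_type S).
Arguments sub_val {T S} S0 x.

(* Topological support, for [mu] a set function on the subsets of [T]. *)
Definition support (R : realType) (T : topologicalType)
    (mu : set T -> \bar R) : set T :=
  [set x | forall U, open U -> U x -> (0 < mu U)%E].

Section projections.
Context d1 d2 d3 (X : measurableType d1) (Y : measurableType d2)
  (Z : measurableType d3).

HB.instance Definition _ :=
  isMeasurableFun.Build _ _ (X * Y)%type X fst measurable_fst.
HB.instance Definition _ :=
  isMeasurableFun.Build _ _ (X * Y)%type Y snd measurable_snd.

Definition mpair (f : {mfun Z >-> X}) (g : {mfun Z >-> Y}) (z : Z) : X * Y :=
  (f z, g z).

Let mpair_measurable f g : measurable_fun [set: Z] (mpair f g).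
Proof. exact: measurable_fun_pair. Qed.

HB.instance Definition _ f g :=
  isMeasurableFun.Build _ _ Z (X * Y)%type (mpair f g) (mpair_measurable f g).

End projections.

Section kernel_comap.
Context d1 d2 d3 (X : measurableType d1) (Y : measurableType d2)
  (Z : measurableType d3) (R : realType).
Variables (k : R.-pker Y ~> Z) (f : {mfun X >-> Y}).

Definition kcomap : X -> {measure set Z -> \bar R} := fun x => k (f x).

Let kcomap_measurable (U : set Z) :
  measurable U -> measurable_fun [set: X] (kcomap ^~ U).
Proof.
move=> mU.
apply: (measurableT_comp (measurable_kernel k U mU)) => //.
Qed.

HB.instance Definition _ :=
  isKernel.Build _ _ X Z R kcomap kcomap_measurable.

Let kcomap_prob x : kcomap x [set: Z] = 1%E.
Proof. exact: prob_kernel. Qed.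

HB.instance Definition _ :=
  Kernel_isProbability.Build _ _ X Z R kcomap kcomap_prob.

End kernel_comap.

Section semidirect_product.
Context d1 d2 (X : measurableType d1) (Y : measurableType d2) (R : realType).
Variables (mu : probability X R) (k : R.-pker X ~> Y).
Local Open Scope ereal_scope.

(* Law of a pair (x, y) with x ~ mu and y ~ k(x). *)
Definition semidirect (A : set (X * Y)) : \bar R :=
  \int[mu]_x k x (xsection A x).

Let semidirect0 : semidirect set0 = 0.
Proof.
by apply: integral0_eq => x _; rewrite xsection0 measure0.
Qed.

Let semidirect_ge0 A : 0 <= semidirect A.
Proof. exact: integral_ge0. Qed.

Let semidirect_sigma_additive : semi_sigma_additive semidirect.
Proof.
move=> F mF tF mUF.
have mk (i : nat) : measurable_fun [set: X] (fun x => k x (xsection (F i) x)).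
  by apply: measurable_fun_xsection_finite_kernel; rewrite inE.
rewrite /semidirect (_ : (fun n => _) = (fun n =>
    \int[mu]_x \sum_(0 <= i < n) k x (xsection (F i) x))); last first.
  by apply/funext => n; rewrite ge0_integral_sum.
rewrite [X in _ --> X](_ : _ =
    \int[mu]_x limn (fun n => \sum_(0 <= i < n) k x (xsection (F i) x))).
  apply: cvg_monotone_convergence => //.
  - by move=> n; exact: emeasurable_sum.
  - by move=> n x _; exact: sume_ge0.
  - by move=> x _ a b ab; exact: lee_sum_nneg_natr.
apply: eq_integral => x _; rewrite xsection_bigcup measure_semi_bigcup//.
- by move=> i; exact: measurable_xsection.
- exact: trivIset_xsection.
- by apply: bigcup_measurable => i _; exact: measurable_xsection.
Qed.

HB.instance Definition _ := isMeasure.Build _ _ R semidirect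
  semidirect0 semidirect_ge0 semidirect_sigma_additive.

Let semidirect_setT : semidirect [set: X * Y] = 1.
Proof.
have xsT (x : X) : xsection [set: X * Y] x = [set: Y].
  by apply/seteqP; split => y _ //; exact/xsectionP.
rewrite /semidirect; under eq_integral do rewrite xsT prob_kernel.
rewrite integral_cst// mul1e; exact: probability_setT.
Qed.

HB.instance Definition _ :=
  Measure_isProbability.Build _ _ R semidirect semidirect_setT.

End semidirect_product.

(* A condition on a kernel [k]: for [k] a firm strategy it is identifiability,
   for [k] the conditional law of the other firm's signal given own signal it is
   the condition on the joint signal distribution. *)
Definition identifiable d1 d2 (S : measurableType d1) (X : measurableType d2)
    (R : realType) (P : probability S R) (k : R.-pker S ~> X) : Prop :=
  forall g : X -> R, measurable_fun [set: X] g -> bounded_fun g ->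
  {ae P, forall s, (\int[k s]_x (g x)%:E = 0)%E} ->
  {ae P, forall s, k s [set x | g x = 0] = 1%E}.

(* [share], [stat], [gov_payoff], [reward] are the maps m, tau, u_G, v;
   [prior] is the law of theta and [signal_law] that of (s_A, s_B) given theta. *)
Record dual_game (R : realType) (n : nat)
    dXA dXB dT dA (XA : measurableType dXA) (XB : measurableType dXB)
    (T : measurableType dT) (A : measurableType dA) := DualGame {
  Theta : set 'rV[R]_n;
  SA : set 'rV[R]_n;
  SB : set 'rV[R]_n;
  Theta0 : Theta !=set0;
  SA0 : SA !=set0;
  SB0 : SB !=set0;
  prior : probability (borel_sub Theta0) R;
  signal_law : R.-pker borel_sub Theta0 ~>
    (borel_sub SA0 * borel_sub SB0)%type;
  share : {mfun (XA * XB)%type >-> R};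
  stat : {mfun (XA * XB)%type >-> T};
  gov_payoff : {mfun (XA * XB * A * borel_sub Theta0)%type >-> R};
  reward : {mfun A >-> R}
}.

Section game.
Context (R : realType) (n : nat) dXA dXB dT dA
  (XA : measurableType dXA) (XB : measurableType dXB)
  (T : measurableType dT) (A : measurableType dA)
  (G : dual_game R n XA XB T A).
Local Open Scope ereal_scope.

Local Notation state := (borel_sub (Theta0 G)).
Local Notation signalA := (borel_sub (SA0 G)).
Local Notation signalB := (borel_sub (SB0 G)).

Definition joint_law : probability (state * (signalA * signalB))%type R :=
  semidirect (prior G) (signal_law G).

Definition F_AB : probability (signalA * signalB)%type R :=
  distribution joint_law snd.
Definition F_A : probability signalA R := distribution F_AB fst.
Definition F_B : probability signalB R := distribution F_AB snd.


(* [kA] (resp. [kB]) is a regular conditional law of the other firm's signal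
   given own signal; such kernels exist, signal spaces being standard Borel,
   and are unique up to null sets of own signals. *)
Definition cond_law_A (kA : R.-pker signalA ~> signalB) : Prop :=
  forall (U : set signalA) (V : set signalB), measurable U -> measurable V ->
  F_AB (U `*` V) = \int[F_A]_(sA in U) kA sA V.
Definition cond_law_B (kB : R.-pker signalB ~> signalA) : Prop :=
  forall (U : set signalA) (V : set signalB), measurable U -> measurable V ->
  F_AB (U `*` V) = \int[F_B]_(sB in V) kB sB U.

Definition payoffA (xA : XA) (xB : XB) (a : A) : R :=
  (share G (xA, xB) + reward G a)%R.
Definition payoffB (xA : XA) (xB : XB) (a : A) : R :=
  (- share G (xA, xB) - reward G a)%R.

Definition v_alpha (alpha : R.-pker T ~> A) (xA : XA) (xB : XB) : R :=
  (\int[alpha (stat G (xA, xB))]_a reward G a)%R.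

Section profile.
Variables (sigmaA : R.-pker signalA ~> XA) (sigmaB : R.-pker signalB ~> XB)
  (alpha : R.-pker T ~> A).

(* Joint law of (((s_A, s_B), x_A), x_B). *)
Definition play_law : probability (signalA * signalB * XA * XB)%type R :=
  semidirect (semidirect F_AB (kcomap sigmaA fst))
    (kcomap sigmaB (snd \o fst)).

Definition action_law : probability (XA * XB)%type R :=
  distribution play_law (mpair (snd \o fst) snd).

(* Joint law of ((((theta, (s_A, s_B)), x_A), x_B), a). *)
Definition outcome_law :
    probability (state * (signalA * signalB) * XA * XB * A)%type R :=
  semidirect
    (semidirect
      (semidirect joint_law (kcomap sigmaA (fst \o snd)))
      (kcomap sigmaB (snd \o snd \o fst)))
    (kcomap alpha (stat G \o mpair (snd \o fst) snd)).

Definition gov_utility (w : state * (signalA * signalB) * XA * XB * A) : R :=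
  let: (theta, _, xA, xB, a) := w in gov_payoff G (xA, xB, a, theta).

Definition gov_value : \bar R := \int[outcome_law]_w (gov_utility w)%:E.

Definition gov_value_defined : Prop :=
  \int[outcome_law]_w (EFin \o gov_utility)^\+ w < +oo \/
  \int[outcome_law]_w (EFin \o gov_utility)^\- w < +oo.

(* Expected payoff of a firm with signal [s] that draws its action from [mu]. *)
Definition interimA (kA : R.-pker signalA ~> signalB)
    (mu : {measure set XA -> \bar R}) (s : signalA) : \bar R :=
  \int[kA s]_sB \int[mu]_xA \int[sigmaB sB]_xB
    \int[alpha (stat G (xA, xB))]_a (payoffA xA xB a)%:E.
Definition interimB (kB : R.-pker signalB ~> signalA)
    (mu : {measure set XB -> \bar R}) (s : signalB) : \bar R :=
  \int[kB s]_sA \int[sigmaA sA]_xA \int[mu]_xB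
    \int[alpha (stat G (xA, xB))]_a (payoffB xA xB a)%:E.

End profile.

Record bayes_nash (kA : R.-pker signalA ~> signalB)
    (kB : R.-pker signalB ~> signalA) (sigmaA : R.-pker signalA ~> XA)
    (sigmaB : R.-pker signalB ~> XB) (alpha : R.-pker T ~> A) : Prop := {
  bayes_nash_A : {ae F_A, forall s, forall mu : probability XA R,
    interimA sigmaB alpha kA mu s <= interimA sigmaB alpha kA (sigmaA s) s};
  bayes_nash_B : {ae F_B, forall s, forall mu : probability XB R,
    interimB sigmaA alpha kB mu s <= interimB sigmaA alpha kB (sigmaB s) s};
  bayes_nash_G : forall alpha' : R.-pker T ~> A,
    gov_value sigmaA sigmaB alpha' <= gov_value sigmaA sigmaB alpha
}.

Record standing_assumptions : Prop := {
  state_sb : standard_borel R state;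
  signalA_sb : standard_borel R signalA;
  signalB_sb : standard_borel R signalB;
  XA_sb : standard_borel R XA;
  XB_sb : standard_borel R XB;
  stat_sb : standard_borel R T;
  action_sb : standard_borel R A;
  F_A_support : support (fun U => F_A (sub_val (SA0 G) @^-1` U)) = SA G;
  F_B_support : support (fun U => F_B (sub_val (SB0 G) @^-1` U)) = SB G;
  F_AB_abs_cont : F_AB `<< (F_A \x F_B);
  share_itv : forall x, (0 <= share G x <= 1)%R;
  reward_bounded : bounded_fun (reward G);
  gov_values_defined : forall sigmaA sigmaB alpha,
    gov_value_defined sigmaA sigmaB alpha
}.

End game.

(* Main.v *)
(* The dual-sphere game is zero-sum, with payoff h = m + v_alpha for firm A. Let
   M_A, M_B be the unconditional laws of the actions and W the equilibrium value
   for A. A signal-independent action x of A meets an opponent distributed as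
   M_B, so optimality of A gives W >= \int h(x, y) dM_B(y), and symmetrically for
   B; integrating both against M_A and M_B yields W = \int\int h dM_A dM_B. Hence
   M_A-almost every x is an optimal reply to almost every signal of A. Two such
   actions x, x0 earn the same interim payoff, so identifiability of the signals
   and then of B's strategy gives h(x, .) = h(x0, .) M_B-almost everywhere. With
   the same statement for B, h is constant (M_A x M_B)-almost everywhere, and
   absolute continuity of the signals transfers this to the play. *)

From HB Require Import structures.
Require Import Defs.
From mathcomp Require Import all_boot all_order all_algebra.
From mathcomp Require Import all_classical all_reals all_analysis.
From mathcomp Require Import measurable_realfun lra.

Set Implicit Arguments.
Unset Strict Implicit.
Unset Printing Implicit Defensive.

Import Order.TTheory GRing.Theory Num.Theory.
Import numFieldNormedType.Exports.
Local Open Scope classical_set_scope.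
Local Open Scope ring_scope.

(** * Bounded measurable functions and their integrals against probabilities *)

Definition bounded_measurable (R : realType) d (T : measurableType d)
    (f : T -> R) : Prop :=
  measurable_fun [set: T] f /\ exists K, forall x, `|f x| <= K.

Section bounded_measurable.
Context (R : realType) d (T : measurableType d).
Implicit Types (f g : T -> R) (P : probability T R).

Lemma bounded_measurable_cst (r : R) : bounded_measurable (fun _ : T => r).
Proof. by split; last by exists `|r|. Qed.

Lemma bounded_measurableD f g : bounded_measurable f -> bounded_measurable g ->
  bounded_measurable (fun x => f x + g x).
Proof.
move=> [mf [K fK]] [mg [L gL]]; split; first exact: measurable_funD.
by exists (K + L) => x; rewrite (le_trans (ler_normD _ _))// lerD.
Qed.

Lemma bounded_measurableN f : bounded_measurable f ->
  bounded_measurable (fun x => - f x).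
Proof.
move=> [mf [K fK]]; split; first exact: measurableT_comp.
by exists K => x; rewrite normrN.
Qed.

Lemma bounded_measurableB f g : bounded_measurable f -> bounded_measurable g ->
  bounded_measurable (fun x => f x - g x).
Proof. by move=> bf /bounded_measurableN; exact: bounded_measurableD. Qed.

Lemma bounded_measurable_comp d' (Z : measurableType d') (p : Z -> T) f :
  measurable_fun [set: Z] p -> bounded_measurable f ->
  bounded_measurable (fun z => f (p z)).
Proof.
by move=> mp [mf [K fK]]; split; [exact: measurableT_comp|exists K].
Qed.

Lemma bounded_measurable_bounded_fun f : bounded_measurable f -> bounded_fun f.
Proof.
move=> [_ [K fK]]; exists K; split; first exact: num_real.
by move=> M KM x _; exact: le_trans (fK x) (ltW KM).
Qed.

Lemma bounded_measurable_integrable P f : bounded_measurable f ->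
  P.-integrable [set: T] (EFin \o f).
Proof.
move=> bf; apply: measurable_bounded_integrable => //.
- by rewrite [X in (X < _)%E]probability_setT ltry.
- exact: bf.1.
- exact: bounded_measurable_bounded_fun.
Qed.

Lemma EFin_Rintegral P f : bounded_measurable f ->
  (\int[P]_x (f x)%:E = (\int[P]_x f x)%:E)%E.
Proof.
move=> bf; rewrite /Rintegral fineK//; apply: integrable_fin_num => //.
exact: bounded_measurable_integrable.
Qed.

Lemma bounded_RintegralD P f g : bounded_measurable f -> bounded_measurable g ->
  \int[P]_x (f x + g x) = \int[P]_x f x + \int[P]_x g x.
Proof. by move=> bf bg; rewrite RintegralD//; exact: bounded_measurable_integrable. Qed.

Lemma bounded_RintegralB P f g : bounded_measurable f -> bounded_measurable g ->
  \int[P]_x (f x - g x) = \int[P]_x f x - \int[P]_x g x.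
Proof. by move=> bf bg; rewrite RintegralB//; exact: bounded_measurable_integrable. Qed.

Lemma Rintegral_prob_cst P (r : R) : \int[P]_x r = r.
Proof. by rewrite Rintegral_cst// [X in fine X]probability_setT mulr1. Qed.

Lemma bounded_RintegralN P f : bounded_measurable f ->
  \int[P]_x (- f x) = - \int[P]_x f x.
Proof.
move=> bf; under eq_Rintegral do rewrite -[- _]sub0r.
rewrite (bounded_RintegralB P (bounded_measurable_cst 0) bf).
by rewrite Rintegral_prob_cst sub0r.
Qed.

Lemma le_bounded_Rintegral P f g : bounded_measurable f -> bounded_measurable g ->
  (forall x, f x <= g x) -> \int[P]_x f x <= \int[P]_x g x.
Proof.
by move=> bf bg fg; apply: le_Rintegral => //; exact: bounded_measurable_integrable.
Qed.

Lemma normr_Rintegral_le P f K : bounded_measurable f ->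
  (forall x, `|f x| <= K) -> `|\int[P]_x f x| <= K.
Proof.
move=> bf fK; rewrite ler_norml -[in X in X && _](Rintegral_prob_cst P (- K)).
rewrite -[in X in _ && X](Rintegral_prob_cst P K).
by apply/andP; split; apply: le_bounded_Rintegral => //;
  try exact: bounded_measurable_cst; move=> x;
  move: (fK x); rewrite ler_norml => /andP[].
Qed.

Lemma ae_Rintegral_norm P f : bounded_measurable f ->
  {ae P, forall x, 0 <= f x} -> \int[P]_x f x = \int[P]_x `|f x|.
Proof.
move=> bf f0; rewrite /Rintegral; congr fine; apply: ae_eq_integral => //.
- by apply/measurable_EFinP; exact: bf.1.
- by apply/measurable_EFinP; apply: measurableT_comp => //; exact: bf.1.
- by apply: filterS f0 => x f0 _; rewrite ger0_norm.
Qed.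

Lemma ae_Rintegral_ge0 P f : bounded_measurable f ->
  {ae P, forall x, 0 <= f x} -> 0 <= \int[P]_x f x.
Proof.
by move=> bf f0; rewrite (ae_Rintegral_norm bf f0); exact: Rintegral_ge0.
Qed.

(** Equality case of optimality: losses that are almost surely nonnegative and have nonpositive mean
    vanish almost surely, since [f] may be replaced by its absolute value. *)
Lemma ae_Rintegral_eq0 P f : bounded_measurable f ->
  {ae P, forall x, 0 <= f x} -> \int[P]_x f x <= 0 ->
  {ae P, forall x, f x = 0}.
Proof.
move=> bf f0 If.
have {}If : \int[P]_x `|f x| = 0.
  by apply/eqP; rewrite eq_le -{1}ae_Rintegral_norm// If Rintegral_ge0.
have bnf : bounded_measurable (fun x => `|f x|).
  split; first by apply: measurableT_comp => //; exact: bf.1.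
  by have [_ [K fK]] := bf; exists K => x; rewrite normr_id.
have : (\int[P]_x `|(f x)%:E| = 0)%E.
  by under eq_integral do rewrite abse_EFin; rewrite EFin_Rintegral// If.
move/(ae_eq_integral_abs P measurableT).
have mf : measurable_fun setT (EFin \o f) by apply/measurable_EFinP; exact: bf.1.
by move=> /(_ mf); apply: filterS => x /(_ I) [].
Qed.

End bounded_measurable.

(** * Averages over probability kernels, and their measurability *)

Section kernel_average.
Context (R : realType) d1 d2 (X : measurableType d1) (Y : measurableType d2).

(** A kernel yields only a measure at each point; this copy carries the probability structure, so
    that the lemmas on probabilities apply to [k x]. *)
Definition kernel_prob (k : R.-pker X ~> Y) (x : X) : set Y -> \bar R := k x.

HB.instance Definition _ k x := Measure.copy (kernel_prob k x) (k x).

HB.instance Definition _ k x :=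
  Measure_isProbability.Build _ _ _ (kernel_prob k x) (@prob_kernel _ _ _ _ _ k x).

(** Makes a fixed law a special case of a kernel, in particular a mixed action that ignores the
    signal. *)
Definition const_kernel (P : probability Y R) (_ : X) :
  {measure set Y -> \bar R} := P.

HB.instance Definition _ P := isKernel.Build _ _ X Y R (const_kernel P)
  (fun U _ => measurable_cst (P U)).

HB.instance Definition _ P := Kernel_isProbability.Build _ _ X Y R
  (const_kernel P) (fun=> probability_setT P).

Lemma measurable_integral_kernel_comp d3 (Z : measurableType d3)
    (k : R.-pker X ~> Y) (p : Z -> X) (f : Z -> Y -> \bar R) :
  measurable_fun [set: Z] p -> (forall z y, 0 <= f z y)%E ->
  measurable_fun [set: Z * Y] (fun zy => f zy.1 zy.2) ->
  measurable_fun [set: Z] (fun z => \int[k (p z)]_y f z y)%E.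
Proof.
move=> mp f0 mf.
pose pm := isMeasurableFun.Build _ _ Z X p mp.
pose q : {mfun Z >-> X} := HB.pack p pm.
exact: (measurable_fun_integral_finite_kernel (fun zy => f zy.1 zy.2)
  (kcomap k q)).
Qed.

Lemma bounded_measurable_section d3 (Z : measurableType d3) (f : Z -> Y -> R) z :
  bounded_measurable (fun zy : Z * Y => f zy.1 zy.2) -> bounded_measurable (f z).
Proof.
move=> bf; apply: (bounded_measurable_comp (p := fun y => (z, y)) _ bf).
exact: pair1_measurable.
Qed.

(** The parameter [z] may have coordinates that the kernel does not read, so iterated averages are
    handled one integral at a time. *)
Lemma bounded_measurable_average d3 (Z : measurableType d3)
    (k : R.-pker X ~> Y) (p : Z -> X) (f : Z -> Y -> R) :
  measurable_fun [set: Z] p ->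
  bounded_measurable (fun zy : Z * Y => f zy.1 zy.2) ->
  bounded_measurable (fun z => \int[k (p z)]_y f z y).
Proof.
move=> mp bf; have [mf [K fK]] := bf.
have bfz z : bounded_measurable (f z) by exact: bounded_measurable_section.
split; last first.
  exists K => z; apply: (@normr_Rintegral_le _ _ _ (kernel_prob k (p z))) => // y.
  exact: (fK (z, y)).
(* The library's measurability lemma is for nonnegative integrands: shift by K. *)
have -> : (fun z => \int[k (p z)]_y f z y) =
    (fun z => fine (\int[k (p z)]_y (f z y + K)%:E)%E - K).
  apply/funext => z; rewrite -[fine _]/(\int[kernel_prob k (p z)]_y (f z y + K)).
  rewrite (bounded_RintegralD (kernel_prob k (p z)) (bfz z) (bounded_measurable_cst _ K)).
  by rewrite Rintegral_prob_cst addrK.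
apply: measurable_funB => //; apply: measurableT_comp => //.
apply: measurable_integral_kernel_comp => //.
- move=> z y; rewrite lee_fin -lerBlDr sub0r.
  by have := fK (z, y); rewrite ler_norml => /andP[].
- by apply/measurable_EFinP; exact: measurable_funD.
Qed.

Lemma bounded_measurable_Rintegral (P : probability Y R) (f : X -> Y -> R) :
  bounded_measurable (fun z : X * Y => f z.1 z.2) ->
  bounded_measurable (fun x => \int[P]_y f x y).
Proof. exact: (@bounded_measurable_average _ X (const_kernel P) id f). Qed.

End kernel_average.

(** Interim payoffs are nested extended-real integrals, while the argument computes with real ones.
    The two agree because the inner average is bounded and measurable at each level. *)
Lemma EFin_Rintegral3 (R : realType) d1 d2 d3 (S : measurableType d1)
    (X : measurableType d2) (Y : measurableType d3) (P : probability S R)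
    (k : R.-pker S ~> X) (l : R.-pker S ~> Y) (h : X -> Y -> R) :
  bounded_measurable (fun z : X * Y => h z.1 z.2) ->
  (\int[P]_s \int[k s]_x \int[l s]_y (h x y)%:E =
    (\int[P]_s \int[k s]_x \int[l s]_y h x y)%:E)%E.
Proof.
move=> bh.
have b1 : bounded_measurable (fun w : S * X => \int[l w.1]_y h w.2 y).
  apply: (bounded_measurable_average l (p := fst) (f := fun w : S * X => h w.2)) => //.
  apply: (bounded_measurable_comp (p := fun w : S * X * Y => (w.1.2, w.2)) _ bh).
  apply: measurable_fun_pair => //.
  exact: measurableT_comp.
have b2 : bounded_measurable (fun s => \int[k s]_x \int[l s]_y h x y).
  exact: (bounded_measurable_average k (p := id)
    (f := fun s x => \int[l s]_y h x y)).
rewrite -EFin_Rintegral//; apply: eq_integral => s _.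
transitivity (\int[kernel_prob k s]_x (\int[l s]_y h x y)%:E)%E.
  apply: eq_integral => x _; apply: (EFin_Rintegral (kernel_prob l s)).
  exact: (bounded_measurable_section (f := h)).
apply: EFin_Rintegral.
exact: (bounded_measurable_section (f := fun s x => \int[l s]_y h x y)).
Qed.

Lemma Rintegral_dirac (R : realType) d (T : measurableType d) (x : T)
    (f : T -> R) : measurable_fun [set: T] f -> \int[\d_x]_y f y = f x.
Proof.
move=> mf; rewrite /Rintegral integral_dirac//; last exact/measurable_EFinP.
by rewrite diracT mul1e.
Qed.

(** * Mixtures of a kernel over a probability *)

Section mixture.
Context (R : realType) d1 d2 (X : measurableType d1) (Y : measurableType d2).
Variables (P : probability X R) (k : R.-pker X ~> Y).

(** A predicate, because it must also cover laws already given otherwise: marginal signal laws and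
    semidirect products. *)
Definition is_mixture (M : set Y -> \bar R) : Prop :=
  forall U, measurable U -> M U = (\int[P]_x k x U)%E.

(** For [P] a signal law and [k] a strategy, this is the unconditional law of the action. *)
Definition mixture : probability Y R := distribution (semidirect P k) snd.

Lemma is_mixture_mixture : is_mixture mixture.
Proof.
move=> U mU; apply: eq_integral => x _; congr (k x _).
by apply/seteqP; split => y /=; [move/xsectionP|move=> Uy; apply/xsectionP].
Qed.

Lemma ge0_integral_mixture (M : {measure set Y -> \bar R}) (f : Y -> \bar R) :
  is_mixture M -> (forall y, 0 <= f y)%E -> measurable_fun [set: Y] f ->
  (\int[M]_y f y = \int[P]_x \int[k x]_y f y)%E.
Proof.
move=> hM f0 mf.
(* The mixture is a kernel composition started from the one-point space [unit]: first the constant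
   kernel [P], then [k]. *)
pose sndm : {mfun (unit * X)%type >-> X} := snd.
rewrite -(@integral_kcomp _ _ _ unit X Y R
  (const_kernel P) (kcomap k sndm) tt f f0 mf).
by apply: eq_measure_integral => U mU _; rewrite hM.
Qed.

Lemma Rintegral_mixture (M : probability Y R) (f : Y -> R) :
  is_mixture M -> bounded_measurable f ->
  \int[M]_y f y = \int[P]_x \int[k x]_y f y.
Proof.
move=> hM bf; have [mf [K fK]] := bf.
have bk := bounded_measurable_cst _ K.
have bfK : bounded_measurable (fun y => f y + K) by exact: bounded_measurableD.
have bI (g : Y -> R) : bounded_measurable g ->
    bounded_measurable (fun x => \int[k x]_y g y).
  move=> bg; apply: (@bounded_measurable_average _ _ _ _ _ _ X k id) => //.
  exact: bounded_measurable_comp.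
have kfK x : \int[k x]_y (f y + K) = \int[k x]_y f y + K.
  rewrite -[LHS]/(\int[kernel_prob k x]_y (f y + K)).
  by rewrite (bounded_RintegralD _ bf (bk _ _)) Rintegral_prob_cst.
(* Adding [K] makes the integrand nonnegative; the shift cancels because every measure here has mass
   one. *)
suff : \int[M]_y (f y + K) = \int[P]_x \int[k x]_y (f y + K).
  rewrite (bounded_RintegralD M bf (bk _ _)) Rintegral_prob_cst.
  under [X in _ = X -> _]eq_Rintegral do rewrite kfK.
  rewrite (bounded_RintegralD P (bI _ bf) (bk _ _)) Rintegral_prob_cst.
  exact: addIr.
apply: EFin_inj; rewrite -!EFin_Rintegral//; last exact: bI.
rewrite (ge0_integral_mixture hM); last 2 first.
- move=> y; rewrite lee_fin -lerBlDr sub0r.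
  by have := fK y; rewrite ler_norml => /andP[].
- by apply/measurable_EFinP; exact: bfK.1.
by apply: eq_integral => x _; rewrite (EFin_Rintegral (kernel_prob k x)).
Qed.

(** If [M N = 0], the nonnegative function [k x N] has zero [P]-integral, so it vanishes almost
    everywhere. *)
Lemma ae_mixture (M : {measure set Y -> \bar R}) (Q : Y -> Prop) :
  is_mixture M -> {ae M, forall y, Q y} ->
  {ae P, forall x, {ae k x, forall y, Q y}}.
Proof.
move=> hM [N [mN N0 QN]]; move: N0; rewrite hM// => N0.
have : (\int[P]_x `|k x N| = 0)%E.
  by under eq_integral do rewrite gee0_abs//.
move/(ae_eq_integral_abs P measurableT (measurable_kernel k N mN)).
by apply: filterS => x /(_ I) /= kN; exists N.
Qed.

(** Identifiability makes almost every [k x] concentrate on the zeros of [g]; averaging over [P]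
    makes the complement [M]-null. *)
Lemma identifiable_mixture (M : {measure set Y -> \bar R}) (g : Y -> R) :
  is_mixture M -> identifiable P k -> bounded_measurable g ->
  {ae P, forall x, \int[k x]_y g y = 0} -> {ae M, forall y, g y = 0}.
Proof.
move=> hM idk bg g0.
have mg0 : measurable [set y | g y = 0].
  by rewrite -[X in measurable X]setTI; exact: (bg.1 measurableT [set 0]).
have := idk g bg.1 (bounded_measurable_bounded_fun bg).
have /[swap]/[apply] kg : {ae P, forall s, (\int[k s]_y (g y)%:E = 0)%E}.
  apply: filterS g0 => x gx.
  by rewrite (EFin_Rintegral (kernel_prob k x) bg); congr EFin.
exists (~` [set y | g y = 0]); split => //; first exact: measurableC.
rewrite hM; last exact: measurableC.
have -> : (0 = \int[P]_x (cst 0 x) :> \bar R)%E by rewrite integral0.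
apply: ae_eq_integral => //; first exact/measurable_kernel/measurableC.
apply: filterS kg => x kx _.
rewrite -[LHS]/(kernel_prob k x (~` _)) probability_setC//.
by rewrite [X in (_ - X)%E]kx subee.
Qed.

End mixture.

Lemma ge0_integral_eq0P (R : realType) d (T : measurableType d)
    (mu : {measure set T -> \bar R}) (f : T -> \bar R) :
  measurable_fun [set: T] f -> (forall x, 0 <= f x)%E ->
  (\int[mu]_x f x = 0)%E <-> {ae mu, forall x, f x = 0%E}.
Proof.
move=> mf f0.
have -> : (\int[mu]_x f x = \int[mu]_x `|f x|)%E.
  by apply: eq_integral => x _; rewrite gee0_abs.
split=> [/(ae_eq_integral_abs mu measurableT mf)|af].
  by apply: filterS => x /(_ I).
by apply/(ae_eq_integral_abs mu measurableT mf); apply: filterS af => x.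
Qed.

(** * Integration against semidirect products *)

Section semidirect_integral.
Context (R : realType) d1 d2 (X : measurableType d1) (Y : measurableType d2).

HB.instance Definition _ (x : X) := isMeasurableFun.Build _ _ Y (X * Y)%type
  (pair x) (pair1_measurable x).

(** The product of the Dirac mass at [x] with [k x]. Its mixture over [P] is the semidirect product,
    so the integration lemmas for mixtures apply. *)
Definition pairing (k : R.-pker X ~> Y) (x : X) :
    {measure set (X * Y) -> \bar R} :=
  distribution (kernel_prob k x) (pair x).

Section pairing_kernel.
Variable k : R.-pker X ~> Y.

Let pairing_xsection x U : pairing k x U = k x (xsection U x).
Proof.
congr (k x _); apply/seteqP.
by split => y /= Uy; [exact/xsectionP|exact/xsectionP].
Qed.

Let measurable_pairing U : measurable U ->
  measurable_fun [set: X] (pairing k ^~ U).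
Proof.
move=> mU; under eq_fun do rewrite pairing_xsection.
by apply: measurable_fun_xsection_finite_kernel; rewrite inE.
Qed.

HB.instance Definition _ :=
  isKernel.Build _ _ X (X * Y)%type R (pairing k) measurable_pairing.

Let pairing_setT x : pairing k x [set: X * Y] = 1%E.
Proof. exact: probability_setT. Qed.

HB.instance Definition _ :=
  Kernel_isProbability.Build _ _ X (X * Y)%type R (pairing k) pairing_setT.

Lemma is_mixture_semidirect (P : probability X R) :
  is_mixture P (pairing k) (semidirect P k).
Proof.
by move=> U mU; apply: eq_integral => x _; rewrite pairing_xsection.
Qed.

End pairing_kernel.

Variables (P : probability X R) (k : R.-pker X ~> Y).

Lemma ge0_integral_semidirect (f : X * Y -> \bar R) :
  (forall z, 0 <= f z)%E -> measurable_fun [set: X * Y] f ->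
  (\int[semidirect P k]_z f z = \int[P]_x \int[k x]_y f (x, y))%E.
Proof.
move=> f0 mf; rewrite (ge0_integral_mixture (@is_mixture_semidirect k P))//.
apply: eq_integral => x _.
by rewrite /pairing ge0_integral_distribution.
Qed.

Lemma Rintegral_semidirect (f : X * Y -> R) : bounded_measurable f ->
  \int[semidirect P k]_z f z = \int[P]_x \int[k x]_y f (x, y).
Proof.
move=> bf; rewrite (Rintegral_mixture (@is_mixture_semidirect k P))//.
apply: eq_Rintegral => x _; congr fine.
rewrite /pairing integral_distribution//.
  by apply/measurable_EFinP; exact: bf.1.
apply: bounded_measurable_integrable.
by apply: (bounded_measurable_comp _ bf); exact: pair1_measurable.
Qed.

End semidirect_integral.

(** * Product spaces: uniqueness of laws, Fubini, exchange of almost-everywhere quantifiers *)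

Section product.
Context (R : realType) d1 d2 (X : measurableType d1) (Y : measurableType d2).

(** Measurable rectangles are closed under intersection and generate the product sigma-algebra. *)
Lemma probability_prod_unique (mu nu : probability (X * Y)%type R) :
  (forall A B, measurable A -> measurable B -> mu (A `*` B) = nu (A `*` B)) ->
  forall U, measurable U -> mu U = nu U.
Proof.
move=> munu U mU.
pose C : set (set (X * Y)) :=
  [set C | exists A, measurable A /\ exists B, measurable B /\ C = A `*` B].
apply: (measure_unique C (fun=> [set: X * Y])) => //.
- rewrite measurable_prod_measurableType //; congr (<<s _ >>).
  rewrite predeqE => D; split => [[A mA [B mB <-]]|[A [mA [B [mB ->]]]]].
    by exists A; split => //; exists B.
  by exists A => //; exists B.
- move=> /= _ _ [X1 [mX1 [X2 [mX2 ->]]]] [Y1 [mY1 [Y2 [mY2 ->]]]].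
  rewrite -setXI; exists (X1 `&` Y1); split; first exact: measurableI.
  by exists (X2 `&` Y2); split => //; exact: measurableI.
- move=> n; exists setT; split => //; exists setT; split => //.
  by rewrite setXTT.
- by rewrite bigcup_const.
- by move=> A [A1 [mA1 [A2 [mA2 ->]]]]; exact: munu.
- by move=> n; rewrite [X in (X < _)%E]probability_setT ltry.
Qed.

Lemma bounded_Fubini (mu : probability X R) (nu : probability Y R)
    (f : X -> Y -> R) :
  bounded_measurable (fun z : X * Y => f z.1 z.2) ->
  \int[mu]_x \int[nu]_y f x y = \int[nu]_y \int[mu]_x f x y.
Proof.
move=> bf.
have bf1 x : bounded_measurable (f x) by exact: bounded_measurable_section.
have bf2 y : bounded_measurable (f ^~ y).
  by apply: (bounded_measurable_comp (p := pair^~ y) _ bf).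
congr fine.
under eq_integral do rewrite -EFin_Rintegral//.
under [RHS]eq_integral do rewrite -EFin_Rintegral//.
apply: (@Fubini _ _ _ _ _ mu nu (fun z => (f z.1 z.2)%:E)).
by apply: bounded_measurable_integrable.
Qed.

(** Both iterated statements say that the complement of [A] is null for the product measure,
    computed by sections along either axis. *)
Lemma ae_ae_swap (mu : probability X R) (nu : probability Y R)
    (A : set (X * Y)) : measurable A ->
  {ae mu, forall x, {ae nu, forall y, A (x, y)}} ->
  {ae nu, forall y, {ae mu, forall x, A (x, y)}}.
Proof.
move=> mA muA; have mN := measurableC mA.
have mx := measurable_fun_xsection nu mN.
have my := measurable_fun_ysection mu mN.
have N0 : (\int[mu]_x nu (xsection (~` A) x) = 0)%E.
  apply/(ge0_integral_eq0P mu) => //; apply: filterS muA => x nuA.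
  apply/negligibleP; first exact: measurable_xsection.
  by move: nuA; apply: negligibleS => y /xsectionP.
have : (\int[nu]_y mu (ysection (~` A) y) = 0)%E.
  rewrite -N0; apply/esym.
  apply: (@product_measure_unique _ _ _ _ _ mu nu (mu \x^ nu)%E) => //.
  by move=> B C mB mC; exact: product_measure2E.
move/(ge0_integral_eq0P nu) => /(_ my) H.
apply: filterS (H _) => // y muA0.
exists (ysection (~` A) y); split => //; first exact: measurable_ysection.
by move=> x /= nA; apply/ysectionP.
Qed.

End product.

Lemma ae_exists (R : realType) d (T : measurableType d) (P : probability T R)
    (Q : T -> Prop) : {ae P, forall x, Q x} -> exists x, Q x.
Proof.
have PT : ProperFilter (almost_everywhere P).
  by apply: ae_properfilter_algebraOfSetsType; rewrite [X in (_ < X)%E]probability_setT.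
exact: filter_ex.
Qed.

(** * Consequences of optimality for a single firm *)

Section one_firm.
Context (R : realType) d1 d2 e1 e2 (S1 : measurableType d1)
  (S2 : measurableType d2) (X1 : measurableType e1) (X2 : measurableType e2).
Variables (P1 : probability S1 R) (P2 : probability S2 R)
  (k1 : R.-pker S1 ~> S2) (sigma1 : R.-pker S1 ~> X1)
  (sigma2 : R.-pker S2 ~> X2) (h : X1 -> X2 -> R) (V : S1 -> R).
Hypotheses (P1k1 : is_mixture P1 k1 P2)
  (bh : bounded_measurable (fun x : X1 * X2 => h x.1 x.2))
  (bV : bounded_measurable V).

Let M1 := mixture P1 sigma1.
Let M2 := mixture P2 sigma2.
Let u x s2 := \int[sigma2 s2]_y h x y.
Let U x s1 := \int[k1 s1]_s2 u x s2.

(** In use [V] is the equilibrium interim payoff of the firm. The other firm reuses the section with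
    roles exchanged and payoff [- h]. *)
Hypothesis U_le_V : {ae P1, forall s1, forall x, U x s1 <= V s1}.

Let bu : bounded_measurable (fun z : X1 * S2 => u z.1 z.2).
Proof.
apply: (@bounded_measurable_average _ _ _ _ _ _ _ sigma2 snd
  (fun z : X1 * S2 => h z.1)) => //.
apply: (bounded_measurable_comp
  (p := fun w : X1 * S2 * X2 => (w.1.1, w.2)) _ bh).
apply: measurable_fun_pair => //.
exact: measurableT_comp.
Qed.

Let bux x : bounded_measurable (u x).
Proof. exact: bounded_measurable_section. Qed.

Let bhx x : bounded_measurable (h x).
Proof. exact: bounded_measurable_section. Qed.

Let bU x : bounded_measurable (U x).
Proof.
apply: (@bounded_measurable_average _ _ _ _ _ _ _ k1 id (fun=> u x)) => //.
exact: bounded_measurable_comp.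
Qed.

(** Total expectation: [k1] averages over [P1] to [P2], and [sigma2] averages over [P2] to [M2]. *)
Let integral_U x : \int[P1]_s U x s = \int[M2]_y h x y.
Proof.
rewrite (Rintegral_mixture (is_mixture_mixture P2 sigma2) (bhx x)).
by rewrite (Rintegral_mixture P1k1 (bux x)).
Qed.

Let U_le_V_at x : {ae P1, forall s, 0 <= V s - U x s}.
Proof. by apply: filterS U_le_V => s /(_ x); rewrite subr_ge0. Qed.

Lemma uninformed_deviation x : \int[M2]_y h x y <= \int[P1]_s V s.
Proof.
rewrite -integral_U -subr_ge0 -bounded_RintegralB//.
by apply: ae_Rintegral_ge0 => //; exact: bounded_measurableB.
Qed.

Lemma payoff_independent_of_action :
  \int[P1]_s V s <= \int[M1]_x \int[M2]_y h x y ->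
  identifiable P1 k1 -> identifiable P2 sigma2 ->
  exists x0, {ae M1, forall x, {ae M2, forall y, h x y = h x0 y}}.
Proof.
move=> V_le idk1 idsigma2.
have bM2 : bounded_measurable (fun x => \int[M2]_y h x y).
  exact: bounded_measurable_Rintegral.
have bW := bounded_measurable_cst X1 (\int[P1]_s V s).
(* Each loss is nonnegative by [uninformed_deviation], and their [M1]-mean is nonpositive by
   hypothesis. *)
have M1_opt : {ae M1, forall x, \int[P1]_s V s - \int[M2]_y h x y = 0}.
  apply: ae_Rintegral_eq0; first exact: bounded_measurableB.
    by apply: aeW => x; rewrite subr_ge0 uninformed_deviation.
  by rewrite bounded_RintegralB// Rintegral_prob_cst subr_le0.
(* The exceptional set of signals depends on [x]; this is harmless, as only [x] and [x0] are
   compared at a time. *)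
have U_eq_V x : \int[P1]_s V s - \int[M2]_y h x y = 0 ->
    {ae P1, forall s, V s - U x s = 0}.
  move=> optx; apply: ae_Rintegral_eq0 => //; first exact: bounded_measurableB.
  by rewrite bounded_RintegralB// integral_U optx.
have [x0 optx0] := ae_exists M1_opt; exists x0.
apply: filterS M1_opt => x optx.
(* Identifiability of [k1] removes the average over the opponent's signal; that of [sigma2] then
   removes the average over its action. *)
have ux : {ae P2, forall s, u x s - u x0 s = 0}.
  apply: (identifiable_mixture P1k1 idk1); first exact: bounded_measurableB.
  have := U_eq_V _ optx; apply: filterS2 (U_eq_V _ optx0) => s Ux0 Ux.
  rewrite -[LHS]/(\int[kernel_prob k1 s]_y (u x y - u x0 y)).
  rewrite bounded_RintegralB//.
  rewrite -[LHS]/(U x s - U x0 s); lra.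
have : {ae M2, forall y, h x y - h x0 y = 0}.
  apply: (identifiable_mixture (is_mixture_mixture P2 sigma2) idsigma2).
    exact: bounded_measurableB.
  apply: filterS ux => s uxs.
  rewrite -[LHS]/(\int[kernel_prob sigma2 s]_y (h x y - h x0 y)).
  by rewrite bounded_RintegralB.
by apply: filterS => y /eqP; rewrite subr_eq0 => /eqP.
Qed.

End one_firm.

(** * The zero-sum game between the two firms *)

Section two_firms.
Context (R : realType) d1 d2 e1 e2 (S1 : measurableType d1)
  (S2 : measurableType d2) (X1 : measurableType e1) (X2 : measurableType e2).
Variables (P1 : probability S1 R) (P2 : probability S2 R)
  (k1 : R.-pker S1 ~> S2) (k2 : R.-pker S2 ~> S1)
  (sigma1 : R.-pker S1 ~> X1) (sigma2 : R.-pker S2 ~> X2)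
  (h : X1 -> X2 -> R).
Hypothesis bh : bounded_measurable (fun x : X1 * X2 => h x.1 x.2).

Let M1 := mixture P1 sigma1.
Let M2 := mixture P2 sigma2.
Let H s1 s2 := \int[sigma1 s1]_x \int[sigma2 s2]_y h x y.
Let V1 s1 := \int[k1 s1]_s2 H s1 s2.
Let V2 s2 := \int[k2 s2]_s1 \int[sigma1 s1]_x \int[sigma2 s2]_y (- h x y).

Hypotheses (P1k1 : is_mixture P1 k1 P2) (P2k2 : is_mixture P2 k2 P1).
(** Both sides are meant as the expectation under one joint signal law; this makes the two
    equilibrium payoffs sum to zero. *)
Hypothesis disintegration : forall f : S1 -> S2 -> R,
  bounded_measurable (fun z : S1 * S2 => f z.1 z.2) ->
  \int[P1]_s1 \int[k1 s1]_s2 f s1 s2 = \int[P2]_s2 \int[k2 s2]_s1 f s1 s2.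
Hypotheses
  (opt1 : {ae P1, forall s1, forall x,
    \int[k1 s1]_s2 \int[sigma2 s2]_y h x y <= V1 s1})
  (opt2 : {ae P2, forall s2, forall y,
    \int[k2 s2]_s1 \int[sigma1 s1]_x (- h x y) <= V2 s2}).
Hypotheses (idk1 : identifiable P1 k1) (idk2 : identifiable P2 k2)
  (idsigma1 : identifiable P1 sigma1) (idsigma2 : identifiable P2 sigma2).

Let bhx x : bounded_measurable (h x).
Proof. exact: bounded_measurable_section. Qed.

Let bu : bounded_measurable (fun z : X1 * S2 => \int[sigma2 z.2]_y h z.1 y).
Proof.
apply: (@bounded_measurable_average _ _ _ _ _ _ _ sigma2 snd
  (fun z : X1 * S2 => h z.1)) => //.
apply: (bounded_measurable_comp
  (p := fun w : X1 * S2 * X2 => (w.1.1, w.2)) _ bh).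
apply: measurable_fun_pair => //.
exact: measurableT_comp.
Qed.

Let bH : bounded_measurable (fun z : S1 * S2 => H z.1 z.2).
Proof.
apply: (@bounded_measurable_average _ _ _ _ _ _ _ sigma1 fst
  (fun (z : S1 * S2) x => \int[sigma2 z.2]_y h x y)) => //.
apply: (bounded_measurable_comp
  (p := fun w : S1 * S2 * X1 => (w.2, w.1.2)) _ bu).
apply: measurable_fun_pair => //.
exact: measurableT_comp.
Qed.

Let bswap e f (A : measurableType e) (B : measurableType f) (g : A -> B -> R) :
  bounded_measurable (fun z : A * B => g z.1 z.2) ->
  bounded_measurable (fun z : B * A => g z.2 z.1).
Proof.
move=> bg; apply: (bounded_measurable_comp (p := fun z => (z.2, z.1)) _ bg).
exact: measurable_fun_pair.
Qed.

Let bh' : bounded_measurable (fun z : X2 * X1 => - h z.2 z.1).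
Proof. exact/bounded_measurableN/bswap. Qed.

Let bV1 : bounded_measurable V1.
Proof. exact: (@bounded_measurable_average _ _ _ _ _ _ _ k1 id H). Qed.

Let V2E s2 : V2 s2 = - \int[k2 s2]_s1 H s1 s2.
Proof.
have bH2 : bounded_measurable (H ^~ s2).
  exact: (bounded_measurable_section (f := fun s2 s1 => H s1 s2) s2 (bswap bH)).
rewrite -[RHS]/(- \int[kernel_prob k2 s2]_s1 H s1 s2) -bounded_RintegralN//.
apply: eq_Rintegral => s1 _.
rewrite -[RHS]/(- \int[kernel_prob sigma1 s1]_x \int[sigma2 s2]_y h x y).
rewrite -bounded_RintegralN//; last first.
  apply: (bounded_measurable_comp (p := fun x => (x, s2)) _ bu).
  exact: pair2_measurable.
apply: eq_Rintegral => x _.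
rewrite -[LHS]/(\int[kernel_prob sigma2 s2]_y - h x y).
by rewrite bounded_RintegralN.
Qed.

Let bV2 : bounded_measurable V2.
Proof.
rewrite (funext V2E); apply: bounded_measurableN.
apply: (@bounded_measurable_average _ _ _ _ _ _ _ k2 id (fun s2 s1 => H s1 s2)) => //.
exact: bswap.
Qed.

Let zero_sum : \int[P2]_s V2 s = - \int[P1]_s V1 s.
Proof.
under eq_Rintegral do rewrite V2E.
rewrite bounded_RintegralN; first by rewrite (disintegration bH).
apply: (@bounded_measurable_average _ _ _ _ _ _ _ k2 id (fun s2 s1 => H s1 s2)) => //.
exact: bswap.
Qed.

Let bM2 : bounded_measurable (fun x => \int[M2]_y h x y).
Proof. exact: bounded_measurable_Rintegral. Qed.

Let bM1 : bounded_measurable (fun y => \int[M1]_x h x y).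
Proof.
apply: (bounded_measurable_Rintegral M1 (f := fun y x => h x y)).
exact: bswap.
Qed.

Let bhy y : bounded_measurable (h ^~ y).
Proof.
exact: (bounded_measurable_section (f := fun y x => h x y) y (bswap bh)).
Qed.

Let M1N y : \int[M1]_x - h x y = - \int[M1]_x h x y.
Proof. exact: bounded_RintegralN. Qed.

(* Neither firm gains by drawing its action independently of its signal, so the
   value of the zero-sum game is attained by independent play. *)
Let value : \int[P1]_s V1 s = \int[M1]_x \int[M2]_y h x y.
Proof.
apply/eqP; rewrite eq_le; apply/andP; split.
  rewrite (bounded_Fubini M1 M2 bh) -(Rintegral_prob_cst M2 (\int[P1]_s V1 s)).
  apply: le_bounded_Rintegral => //; first exact: bounded_measurable_cst.
  move=> y; rewrite -lerN2 -zero_sum -M1N.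
  exact: (uninformed_deviation P2k2 bh' bV2 opt2).
rewrite -[leRHS](Rintegral_prob_cst M1).
apply: le_bounded_Rintegral => //; first exact: bounded_measurable_cst.
exact: (uninformed_deviation P1k1 bh bV1 opt1).
Qed.

Lemma equilibrium_payoff_constant :
  exists c, {ae M1, forall x, {ae M2, forall y, h x y = c}}.
Proof.
have [|x0 hx0] := payoff_independent_of_action (sigma1 := sigma1) P1k1 bh bV1 opt1 _
  idk1 idsigma2; first by rewrite value.
(* For the second firm the payoff is [- h] with its arguments exchanged; the required bound comes
   from [zero_sum], [value] and Fubini. *)
have [|y0 hy0] := payoff_independent_of_action (sigma1 := sigma2) P2k2 bh' bV2 opt2 _
  idk2 idsigma1.
  rewrite zero_sum value (bounded_Fubini M1 M2 bh).
  by under [leRHS]eq_Rintegral do rewrite M1N; rewrite bounded_RintegralN.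
(* The second firm's statement quantifies over [y] first; the order is exchanged so that both
   statements can be combined. *)
have {}hy0 : {ae M1, forall x, {ae M2, forall y, h x y = h x y0}}.
  pose A := [set z : X2 * X1 | h z.2 z.1 - h z.2 y0 = 0].
  have : {ae M1, forall x, {ae M2, forall y, A (y, x)}}.
    apply: ae_ae_swap.
      have bg : bounded_measurable (fun z : X2 * X1 => h z.2 z.1 - h z.2 y0).
        apply: bounded_measurableB; first exact: bswap.
        exact: (bounded_measurable_comp (p := snd) _ (bhy y0)).
      by rewrite -[X in measurable X]setTI; exact: (bg.1 measurableT [set 0]).
    apply: filterS hy0 => y; apply: filterS => x /oppr_inj hxy.
    by rewrite /A /= hxy subrr.
  by apply: filterS => x; apply: filterS => y /eqP; rewrite subr_eq0 => /eqP.
(* A single action good for both statements: through it [h x0 y] equals the number [h x1 y0] for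
   almost every [y]. *)
have [x1 [hx1 hy1]] : exists x, {ae M2, forall y, h x y = h x0 y} /\
    {ae M2, forall y, h x y = h x y0}.
  by apply: (@ae_exists _ _ _ M1); apply: filterS2 hx0 hy0.
exists (h x1 y0); apply: filterS hx0 => x hx.
near=> y.
transitivity (h x0 y); first by near: y.
transitivity (h x1 y); first by apply/esym; near: y.
by near: y.
Unshelve. all: by end_near. Qed.

End two_firms.

(** * Joint signal laws: disintegration and transfer of null sets *)

Section joint_signals.
Context (R : realType) d1 d2 (S1 : measurableType d1) (S2 : measurableType d2).

(** The hypothesis says that [P12] agrees with the semidirect product of [P1] and [k1] on
    rectangles, hence everywhere. *)
Lemma Rintegral_disintegration (P12 : probability (S1 * S2)%type R)
    (P1 : probability S1 R) (k1 : R.-pker S1 ~> S2) (f : S1 * S2 -> R) :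
  (forall U V, measurable U -> measurable V ->
    P12 (U `*` V) = (\int[P1]_(s in U) k1 s V)%E) ->
  bounded_measurable f ->
  \int[P12]_z f z = \int[P1]_s1 \int[k1 s1]_s2 f (s1, s2).
Proof.
move=> hk1 bf; rewrite -Rintegral_semidirect//; congr fine.
apply: eq_measure_integral => W mW _; apply: probability_prod_unique => // U V mU mV.
rewrite hk1// integral_mkcond; apply: eq_integral => s _.
rewrite patchE; case: ifPn => sU; first by rewrite in_xsectionX.
by rewrite notin_xsectionX// measure0.
Qed.

(** With independent signals the actions would follow the product of the mixtures, for which [N] is
    null. So the probability of [N] given both signals vanishes almost everywhere for the product of
    the signal laws, and by absolute continuity for [P12]. *)
Lemma ae_independent_play e1 e2 (X1 : measurableType e1)
    (X2 : measurableType e2) (P12 : probability (S1 * S2)%type R)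
    (P1 : probability S1 R) (P2 : probability S2 R)
    (sigma1 : R.-pker S1 ~> X1) (sigma2 : R.-pker S2 ~> X2)
    (N : set (X1 * X2)) :
  P12 `<< (P1 \x P2)%E -> measurable N ->
  {ae mixture P1 sigma1, forall x,
    {ae mixture P2 sigma2, forall y, ~ N (x, y)}} ->
  (\int[P12]_s \int[sigma1 s.1]_x sigma2 s.2 (xsection N x) = 0)%E.
Proof.
move=> P12_ac mN N0.
have mphi : measurable_fun [set: X1 * S2]
    (fun w => sigma2 w.2 (xsection N w.1)).
  (* The measured set varies with [w]; as the integral of an indicator, the value falls under kernel
     measurability. *)
  have -> : (fun w : X1 * S2 => sigma2 w.2 (xsection N w.1)) =
      (fun w => \int[sigma2 w.2]_y (\1_N (w.1, y))%:E)%E.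
    apply/funext => w.
    rewrite -[X in sigma2 _ X]setIT -integral_indic//; last first.
      exact: measurable_xsection.
    by apply: eq_integral => y _; rewrite !indicE mem_xsection.
  apply: (measurable_integral_kernel_comp sigma2 (p := snd)
    (f := fun (w : X1 * S2) y => (\1_N (w.1, y))%:E)) => //.
  apply/measurable_EFinP.
  apply: (measurableT_comp (f := \1_N : X1 * X2 -> R)) => //.
  apply: measurable_fun_pair => //.
  exact: measurableT_comp.
pose Q (s : S1 * S2) := (\int[sigma1 s.1]_x sigma2 s.2 (xsection N x))%E.
have mQ : measurable_fun [set: S1 * S2] Q.
  apply: (measurable_integral_kernel_comp sigma1 (p := fst)
    (f := fun (s : S1 * S2) x => sigma2 s.2 (xsection N x))) => //.
  apply: (measurableT_comp mphi
    (g := fun z : S1 * S2 * X1 => (z.2, z.1.2))).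
  apply: measurable_fun_pair => //.
  exact: measurableT_comp.
have Q_ge0 s : (0 <= Q s)%E by exact: integral_ge0.
have aeQ : {ae P1, forall s1, {ae P2, forall s2, Q (s1, s2) = 0%E}}.
  have := ae_mixture (is_mixture_mixture P1 sigma1) N0.
  apply: filterS => s1 N0s1.
  have : {ae sigma1 s1, forall x, {ae P2, forall s2,
      sigma2 s2 (xsection N x) = 0%E}}.
    apply: filterS N0s1 => x N0x.
    apply: filterS (ae_mixture (is_mixture_mixture P2 sigma2) N0x) => s2 N0s2.
    apply/negligibleP; first exact: measurable_xsection.
    by move: N0s2; apply: negligibleS => y /xsectionP /[swap]; exact.
  pose A := [set w : X1 * S2 | sigma2 w.2 (xsection N w.1) = 0%E].
  (* The quantifier on [s2] must come first: for almost every [s2], the integrand of [Q] then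
     vanishes for almost every [x]. *)
  move=> /(ae_ae_swap (mu := kernel_prob sigma1 s1) (A := A)) H.
  have mA : measurable A.
    by rewrite -[X in measurable X]setTI; exact: (mphi measurableT [set 0%E]).
  apply: filterS (H mA) => s2 As2.
  apply/(ge0_integral_eq0P (sigma1 s1)) => //.
  by apply: (measurableT_comp mphi (g := pair^~ s2)); exact: pair2_measurable.
apply/(ge0_integral_eq0P P12) => //.
have mQ0 : measurable (~` [set s | Q s = 0%E]).
  apply: measurableC.
  by rewrite -[X in measurable X]setTI; exact: (mQ measurableT [set 0%E]).
exists (~` [set s | Q s = 0%E]); split => //.
apply/(measure0_null_setP P12 mQ0)/P12_ac/(measure0_null_setP _ mQ0).
apply/(ge0_integral_eq0P P1) => //; first exact: measurable_fun_xsection.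
apply: filterS aeQ => s1 Qs1; apply/negligibleP; first exact: measurable_xsection.
by move: Qs1; apply: negligibleS => s2 /xsectionP.
Qed.

End joint_signals.

(** * Translation of the dual-sphere game into the abstract setting *)

Section game.
Context (R : realType) (n : nat) dXA dXB dT dA
  (XA : measurableType dXA) (XB : measurableType dXB)
  (T : measurableType dT) (A : measurableType dA)
  (G : dual_game R n XA XB T A).
Variables (kA : R.-pker borel_sub (SA0 G) ~> borel_sub (SB0 G))
  (kB : R.-pker borel_sub (SB0 G) ~> borel_sub (SA0 G))
  (sigmaA : R.-pker borel_sub (SA0 G) ~> XA)
  (sigmaB : R.-pker borel_sub (SB0 G) ~> XB)
  (alpha : R.-pker T ~> A).
Hypotheses (hkA : cond_law_A kA) (hkB : cond_law_B kB).

(** The rectangle identity of [hkA] with the whole space as first side. *)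
Lemma is_mixture_cond_law_A : is_mixture (F_A G) kA (F_B G).
Proof.
move=> V mV; rewrite -hkA//; congr (F_AB G _).
by apply/seteqP; split => -[x y] //= [].
Qed.

Lemma is_mixture_cond_law_B : is_mixture (F_B G) kB (F_A G).
Proof.
move=> U mU; rewrite -hkB//; congr (F_AB G _).
by apply/seteqP; split => -[x y] //= [].
Qed.

Lemma Rintegral_cond_law (f : borel_sub (SA0 G) -> borel_sub (SB0 G) -> R) :
  bounded_measurable
    (fun z : (borel_sub (SA0 G) * borel_sub (SB0 G))%type => f z.1 z.2) ->
  \int[F_A G]_s \int[kA s]_t f s t = \int[F_B G]_t \int[kB t]_s f s t.
Proof.
move=> bf.
rewrite -(Rintegral_disintegration hkA bf).
(* The law [kB] conditions on the second coordinate, so the pair of signals is swapped before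
   disintegrating. *)
pose F_BA := distribution (F_AB G) (mpair snd fst).
have hBA U V : measurable U -> measurable V ->
    F_BA (U `*` V) = (\int[F_B G]_(t in U) kB t V)%E.
  move=> mU mV; rewrite -hkB//; congr (F_AB G _).
  by apply/seteqP; split => -[x y] /= [].
have bfs : bounded_measurable
    (fun z : (borel_sub (SB0 G) * borel_sub (SA0 G))%type => f z.2 z.1).
  apply: (bounded_measurable_comp (p := fun z => (z.2, z.1)) _ bf).
  exact: measurable_fun_pair.
rewrite -(Rintegral_disintegration hBA bfs); congr fine.
rewrite [RHS]integral_distribution//.
  by apply/measurable_EFinP; exact: bfs.1.
exact: bounded_measurable_integrable.
Qed.

Hypotheses (share01 : forall x, 0 <= share G x <= 1)
  (reward_bd : bounded_fun (reward G)).

(** Firm A's payoff once the government's randomization is integrated out; firm B's is its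
    negative. *)
Definition dual_payoff (xA : XA) (xB : XB) : R :=
  share G (xA, xB) + v_alpha G alpha xA xB.

Let breward : bounded_measurable (reward G).
Proof.
split; first exact: measurable_funP.
(* [bounded_fun] provides as bounds the numbers strictly above [K], hence [K + 1]. *)
have [K [_ rK]] := reward_bd; exists (K + 1) => a.
by apply: (rK (K + 1)) => //; rewrite ltrDl.
Qed.

Lemma bounded_measurable_dual_payoff :
  bounded_measurable (fun x : XA * XB => dual_payoff x.1 x.2).
Proof.
have bshare : bounded_measurable (share G).
  split; first exact: measurable_funP.
  by exists 1 => x; have /andP[? ?] := share01 x; rewrite ger0_norm.
apply: bounded_measurableD.
  apply: (bounded_measurable_comp (p := fun x => (x.1, x.2)) _ bshare).
  exact: measurable_fun_pair.
apply: (bounded_measurable_comp (p := fun x : XA * XB => (x.1, x.2))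
  (f := fun x => \int[alpha (stat G x)]_a reward G a)).
  exact: measurable_fun_pair.
apply: (@bounded_measurable_average _ _ _ _ _ _ _ alpha (stat G)
  (fun _ => reward G)) => //.
exact: bounded_measurable_comp.
Qed.

Lemma integral_payoffA xA xB :
  (\int[alpha (stat G (xA, xB))]_a (payoffA G xA xB a)%:E =
    (dual_payoff xA xB)%:E)%E.
Proof.
pose P := kernel_prob alpha (stat G (xA, xB)).
have bs := bounded_measurable_cst A (share G (xA, xB)).
rewrite -[LHS]/(\int[P]_a (payoffA G xA xB a)%:E)%E EFin_Rintegral; last first.
  exact: bounded_measurableD.
by rewrite bounded_RintegralD// Rintegral_prob_cst.
Qed.

Lemma integral_payoffB xA xB :
  (\int[alpha (stat G (xA, xB))]_a (payoffB G xA xB a)%:E =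
    (- dual_payoff xA xB)%:E)%E.
Proof.
pose P := kernel_prob alpha (stat G (xA, xB)).
have bs := bounded_measurable_cst A (- share G (xA, xB)).
rewrite -[LHS]/(\int[P]_a (payoffB G xA xB a)%:E)%E EFin_Rintegral; last first.
  exact: bounded_measurableB.
by rewrite bounded_RintegralB// Rintegral_prob_cst opprD.
Qed.

Lemma interimA_Rintegral (mu : probability XA R) s :
  interimA sigmaB alpha kA mu s =
  (\int[kA s]_t \int[mu]_x \int[sigmaB t]_y dual_payoff x y)%:E.
Proof.
rewrite -[RHS](EFin_Rintegral3 (kernel_prob kA s) (const_kernel mu) sigmaB
  bounded_measurable_dual_payoff).
apply: eq_integral => t _; apply: eq_integral => x _; apply: eq_integral => y _.
exact: integral_payoffA.
Qed.

Lemma interimB_Rintegral (mu : probability XB R) s :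
  interimB sigmaA alpha kB mu s =
  (\int[kB s]_t \int[sigmaA t]_x \int[mu]_y (- dual_payoff x y))%:E.
Proof.
rewrite -[RHS](EFin_Rintegral3 (kernel_prob kB s) sigmaA (const_kernel mu)
  (bounded_measurableN bounded_measurable_dual_payoff)).
apply: eq_integral => t _; apply: eq_integral => x _; apply: eq_integral => y _.
exact: integral_payoffB.
Qed.

(** Given both signals, the two actions are drawn independently. *)
Lemma action_lawE (N : set (XA * XB)) : measurable N ->
  action_law sigmaA sigmaB N =
  (\int[F_AB G]_s \int[sigmaA s.1]_x sigmaB s.2 (xsection N x))%E.
Proof.
move=> mN.
pose f := mpair (snd \o fst) snd :
  borel_sub (SA0 G) * borel_sub (SB0 G) * XA * XB -> XA * XB.
have mW : measurable (f @^-1` N).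
  by rewrite -[X in measurable X]setTI; exact: (measurable_funP f).
rewrite -[LHS]/(\int[semidirect (F_AB G) (kcomap sigmaA fst)]_w
  kcomap sigmaB (snd \o fst) w (xsection (f @^-1` N) w))%E.
rewrite ge0_integral_semidirect//.
by apply: measurable_fun_xsection_finite_kernel; rewrite inE.
Qed.

End game.

Theorem proposition4 (R : realType) (n : nat) (dXA dXB dT dA : measure_display)
    (XA : measurableType dXA) (XB : measurableType dXB)
    (T : measurableType dT) (A : measurableType dA)
    (G : dual_game R n XA XB T A)
    (kA : R.-pker borel_sub (SA0 G) ~> borel_sub (SB0 G))
    (kB : R.-pker borel_sub (SB0 G) ~> borel_sub (SA0 G))
    (sigmaA : R.-pker borel_sub (SA0 G) ~> XA)
    (sigmaB : R.-pker borel_sub (SB0 G) ~> XB)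
    (alpha : R.-pker T ~> A)
    (hG : standing_assumptions G)
    (hkA : cond_law_A kA) (hkB : cond_law_B kB)
    (hA : identifiable (F_A G) kA) (hB : identifiable (F_B G) kB)
    (hBNE : bayes_nash kA kB sigmaA sigmaB alpha)
    (hsA : identifiable (F_A G) sigmaA) (hsB : identifiable (F_B G) sigmaB) :
  exists c : R, {ae action_law sigmaA sigmaB, forall x,
    share G x + v_alpha G alpha x.1 x.2 = c}.
Proof.
have [share01 reward_bd] := (share_itv hG, reward_bounded hG).
pose h := dual_payoff G alpha.
have bh : bounded_measurable (fun x : XA * XB => h x.1 x.2).
  exact: bounded_measurable_dual_payoff.
have PA := is_mixture_cond_law_A hkA; have PB := is_mixture_cond_law_B hkB.
have mhx x : measurable_fun [set: XB] (h x).
  by have [] := bounded_measurable_section x bh.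
have mhB t : measurable_fun [set: XA] (fun x => \int[sigmaB t]_y h x y).
  exact: (bounded_measurable_Rintegral (kernel_prob sigmaB t) bh).1.
have [c hc] : exists c, {ae mixture (F_A G) sigmaA, forall x,
    {ae mixture (F_B G) sigmaB, forall y, h x y = c}}.
  apply: (equilibrium_payoff_constant bh PA PB) => //.
  - exact: Rintegral_cond_law.
  (* The Dirac mass at [x] turns optimality among mixed actions into the bound for the pure action
     [x]. *)
  - apply: filterS (bayes_nash_A hBNE) => s opt x; move: (opt \d_x).
    rewrite -[leRHS]/(interimA sigmaB alpha kA (kernel_prob sigmaA s) s).
    rewrite !interimA_Rintegral// lee_fin; congr (_ <= _).
    by apply: eq_Rintegral => t _; rewrite Rintegral_dirac.
  - apply: filterS (bayes_nash_B hBNE) => s opt y; move: (opt \d_y).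
    rewrite -[leRHS]/(interimB sigmaA alpha kB (kernel_prob sigmaB s) s).
    rewrite !interimB_Rintegral// lee_fin; congr (_ <= _).
    apply: eq_Rintegral => t _; apply: eq_Rintegral => x _.
    by rewrite Rintegral_dirac//; exact: measurableT_comp.
pose N := ~` [set x : XA * XB | h x.1 x.2 = c].
have mN : measurable N.
  apply: measurableC; rewrite -[X in measurable X]setTI.
  exact: (bh.1 measurableT [set c]).
exists c; exists N; split => //.
  rewrite action_lawE// (ae_independent_play (F_AB_abs_cont hG))//.
  apply: filterS hc => x; apply: filterS => y hxy.
  by apply.
by move=> [x y].
Qed.
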